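(* For all integers $k\ge1$, $\theta\ge1$ and $\epsilon>0$, there exists a mechanism that answers the workload $\mathbf{R}_k$ of all one-dimensional range queries over $[k]$ with $O(\log^3\theta/\epsilon^2)$ error per query under $(\epsilon,G^\theta_k)$-Blowfish privacy.
   Context: Databases are histogram vectors $\mathbf{x}\in\mathbb{R}^k$ over $[k]=\{1,\dots,k\}$. $\mathbf{R}_k$ consists of the queries $\mathbf{q}(l,r)\mathbf{x}=\sum_{l\le i\le r}\mathbf{x}_i$ for $1\le l\le r\le k$. The policy graph $G^\theta_k$ has vertex set $[k]$ (no $\bot$) and an edge between distinct $u,v$ iff $|u-v|\le\theta$. Two databases are neighbors under $G^\theta_k$ iff they differ in the value of exactly one record, $u$ in one and $v$ in the other, with $(u,v)$ an edge. A mechanism $\mathcal{M}$ is $(\epsilon,G)$-Blowfish private if $\Pr[\mathcal{M}(\mathbf{x})\in S]\le e^\epsilon\Pr[\mathcal{M}(\mathbf{x}')\in S]$ for all output sets $S$ and all neighbors. Error per query is the data-independent total mean squared error $\max_{\mathbf{x}}\sum_{\mathbf{q}}\mathbb{E}[(\mathbf{q}\mathbf{x}-\mathcal{M}(\mathbf{q},\mathbf{x}))^2]$ divided by the number of queries.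
   Formalization: The bound is C(1+ln θ)^3/ε^2 with a universal constant C, instead of O(log^3 θ/ε^2): at θ=1 the latter is 0, which no private mechanism attains for k≥2; for θ≥2 the two agree up to a constant. *)

(* Defs.v *)
From HB Require Import structures.
From mathcomp Require Import all_boot all_order all_algebra.
From mathcomp Require Import all_classical all_reals all_analysis.
Set Implicit Arguments. Unset Strict Implicit. Unset Printing Implicit Defensive.
Import Order.TTheory GRing.Theory Num.Theory.
Local Open Scope ring_scope.
Local Open Scope classical_set_scope.

(* The workload R_k: all range queries q(l,r), 1 <= l <= r <= k, written on
   the 0-based index type 'I_k, each listed exactly once (k(k+1)/2 queries). *)
Definition range_workload (k : nat) : seq ('I_k * 'I_k) :=
  flatten (map (fun l : 'I_k =>
    map (fun r : 'I_k => (l, r)) (seq.filter (fun r : 'I_k => (l <= r)%N) (enum 'I_k)))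
    (enum 'I_k)).

Definition nqueries (k : nat) : nat := size (range_workload k).

Definition workload_query (k : nat) (j : 'I_(nqueries k)) : 'I_k * 'I_k :=
  tnth (in_tuple (range_workload k)) j.

(* q(l,r) x = sum_{l <= i <= r} x_i ; databases are histograms x in R^k *)
Definition range_answer {R : realType} (k : nat) (q : 'I_k * 'I_k)
    (x : 'I_k -> R) : R :=
  \sum_(i < k | (q.1 <= i <= q.2)%N) x i.

(* Output space: a vector of answers, one per query of the workload, with the
   product (Borel) sigma-algebra on tuples. *)
Definition answers (R : realType) (k : nat) := (nqueries k).-tuple R.

Definition mechanism (R : realType) (k : nat) :=
  ('I_k -> R) -> probability (answers R k) R.

Definition policy_edge (k theta : nat) (u v : 'I_k) : bool :=
  [&& u != v, (u - v <= theta)%N & (v - u <= theta)%N].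

(* Neighbors under G^theta_k: one record changes its value from u to v,
   with (u,v) an edge; on histograms x' = x - e_u + e_v. *)
Definition blowfish_neighbors {R : realType} (k theta : nat)
    (x x' : 'I_k -> R) : Prop :=
  exists u v : 'I_k, policy_edge theta u v /\
    x' = (fun i => x i - (i == u)%:R + (i == v)%:R).

Definition blowfish_private {R : realType} (k theta : nat) (eps : R)
    (M : mechanism R k) : Prop :=
  forall x x' : 'I_k -> R, blowfish_neighbors theta x x' ->
  forall S : set (answers R k), measurable S ->
    (M x S <= (expR eps)%:E * M x' S)%E.

Definition total_sq_error {R : realType} (k : nat) (M : mechanism R k)
    (x : 'I_k -> R) : \bar R :=
  (\sum_(j < nqueries k)
     \int[M x]_y ((range_answer (workload_query j) x - tnth y j) ^+ 2)%:E)%E.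

Definition error_per_query_le {R : realType} (k : nat) (M : mechanism R k)
    (b : R) : Prop :=
  forall x : 'I_k -> R,
    (((nqueries k)%:R)^-1%:E * total_sq_error M x <= b%:E)%E.

(* Main.v *)
(* A move of one record from u to v shifts the answer vector of the workload by
   a column difference, which in terms of prefix counts is the indicator of an
   interval of length at most theta. Such an interval is a signed sum of at most
   2L+1 dyadic intervals of length at most 2^L, where theta <= 2^L, while each
   point lies in only L+1 of them. So add to the true answers independent
   two-sided geometric noise along one direction per dyadic interval: privacy is
   paid 2L+1 times, at noise variance O(L^2/eps^2), and the variances of the
   O(L) directions seen by a query add up to O(L^3/eps^2).

   The noise lives on half-integers, which makes it a mixture of the shifts by
   n + 1/2 and - (n + 1/2) with weights (1 - a)/2 * a^n, and a translation by 1
   changes weights by a factor of exactly a or 1/a. Its variance is at least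
   1/4 though, too much for large eps, so the directions are scaled by
   1/m with m > eps and every unit step is split into m steps. *)

Require Import Defs.
From HB Require Import structures.
From mathcomp Require Import all_boot all_order all_algebra.
From mathcomp Require Import all_classical all_reals all_analysis.
From mathcomp Require Import measurable_realfun zify ring lra.
Import Order.TTheory GRing.Theory Num.Theory.
Local Open Scope ring_scope.
Set Implicit Arguments. Unset Strict Implicit. Unset Printing Implicit Defensive.

(** * Two-sided geometric mixtures of probability measures *)

Lemma geom_weight_ge0 (R : realType) (a : R) (n : nat) :
  0 < a < 1 -> 0 <= (1 - a) / 2 * a ^+ n.
Proof.
move=> /andP[a0 a1]; apply: mulr_ge0; last exact/exprn_ge0/ltW.
by rewrite divr_ge0// subr_ge0 ltW.
Qed.

Lemma geom_series (R : realType) (a : R) : 0 < a < 1 ->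
  (\sum_(0 <= n <oo) ((1 - a) * a ^+ n)%:E = 1 :> \bar R)%E.
Proof.
move=> /andP[a0 a1].
have a1' : `|a| < 1 by rewrite ger0_norm// ltW.
have := @cvg_geometric_series R (1 - a) a a1'.
rewrite divff ?subr_eq0 ?gt_eqF// => h.
apply/cvg_lim => //.
under eq_fun do rewrite sumEFin.
exact: (cvg_EFin (nearW _ _) h).
Qed.

(* [H n] below is the exact value of the tail
   [sum_i (1 - a) a^i (n + i + 1/2)^2], so the partial sums telescope. *)
Lemma geom_second_moment (R : realType) (a : R) : 0 < a < 1 ->
  (\sum_(0 <= n <oo) ((1 - a) * a ^+ n * (n%:R + 2^-1) ^+ 2)%:E
    <= (2 / (1 - a) ^+ 2)%:E :> \bar R)%E.
Proof.
move=> /andP[a0 a1].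
pose u := 1 - a; have u0 : 0 < u by rewrite subr_gt0.
have u1 : u != 0 by rewrite gt_eqF.
pose H (n : nat) : R := (n%:R + 2^-1) ^+ 2 + 2 * (n%:R + 2^-1) * (a / u)
  + a * (1 + a) / u ^+ 2.
have H0 n : 0 <= H n.
  by rewrite /H !addr_ge0// ?sqr_ge0// ?mulr_ge0 ?addr_ge0 ?invr_ge0 ?exprn_ge0// ltW.
have E N : \sum_(0 <= n < N) ((1 - a) * a ^+ n * (n%:R + 2^-1) ^+ 2)
    = H 0%N - a ^+ N * H N.
  elim: N => [|N IH]; first by rewrite big_nil expr0 mul1r subrr.
  rewrite big_nat_recr//= IH /H (exprS a N) -natr1 /u.
  by field; rewrite subr_eq0 gt_eqF.
apply: lime_le.
  apply: is_cvg_nneseries => n _ _; rewrite lee_fin mulr_ge0 ?sqr_ge0//.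
  by rewrite mulr_ge0 ?exprn_ge0 ?ltW// subr_gt0.
near=> N; rewrite sumEFin lee_fin E.
apply: (@le_trans _ _ (H 0%N)).
  by rewrite gerBl mulr_ge0// exprn_ge0// ltW.
rewrite ler_pdivlMr ?exprn_gt0 ?subr_gt0// -/u.
have -> : H 0%N * u ^+ 2 = 2 - 2 * u + u ^+ 2 / 4.
  by rewrite /H /u; field; rewrite subr_eq0 gt_eqF.
have : u <= 1 by rewrite /u gerBl ltW.
nra.
Unshelve. all: by end_near. Qed.

(** [f n] and [g n] are the laws given noise [n + 1/2] and [- (n + 1/2)]. As a series of scaled
    measures, the mixture has values and integrals that are computed term by term. *)
Definition geom_mixture d (T : measurableType d) (R : realType) (a : R)
    (a01 : 0 < a < 1) (f g : nat -> probability T R) : set T -> \bar R :=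
  mseries (fun n => mscale (NngNum (geom_weight_ge0 n a01))
    (measure_add (f n) (g n))) 0.

HB.instance Definition _ d (T : measurableType d) (R : realType) (a : R)
    (a01 : 0 < a < 1) (f g : nat -> probability T R) :=
  Measure.on (geom_mixture a01 f g).

Lemma geom_mixtureE d (T : measurableType d) (R : realType) (a : R)
    (a01 : 0 < a < 1) (f g : nat -> probability T R) (S : set T) :
  (geom_mixture a01 f g S =
   \sum_(0 <= n <oo) ((1 - a) / 2 * a ^+ n)%:E * (f n S + g n S))%E.
Proof.
by rewrite /geom_mixture/= /mseries; apply: eq_eseriesr => n _;
  rewrite /mscale -measure_addE.
Qed.

Lemma geom_mixture_setT d (T : measurableType d) (R : realType) (a : R)
    (a01 : 0 < a < 1) (f g : nat -> probability T R) :
  geom_mixture a01 f g setT = 1%E.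
Proof.
rewrite geom_mixtureE -(geom_series a01).
apply: eq_eseriesr => n _; rewrite !probability_setT -EFinD -EFinM.
by congr EFin; field.
Qed.

HB.instance Definition _ d (T : measurableType d) (R : realType) (a : R)
    (a01 : 0 < a < 1) (f g : nat -> probability T R) :=
  Measure_isProbability.Build d T R (geom_mixture a01 f g)
    (geom_mixture_setT a01 f g).

Lemma integral_geom_mixture d (T : measurableType d) (R : realType) (a : R)
    (a01 : 0 < a < 1) (f g : nat -> probability T R) (h : T -> \bar R) :
  (forall x, 0 <= h x)%E -> measurable_fun setT h ->
  (\int[geom_mixture a01 f g]_x h x =
   \sum_(0 <= n <oo) ((1 - a) / 2 * a ^+ n)%:E *
     (\int[f n]_x h x + \int[g n]_x h x))%E.
Proof.
move=> h0 mh; rewrite /geom_mixture ge0_integral_measure_series//.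
apply: eq_eseriesr => n _.
by rewrite ge0_integral_mscale// ge0_integral_measure_add.
Qed.

(** * Noise along a list of directions *)

(** The law of [b] plus independent noise times each direction: the recursion conditions on the
    noise of the head, whose value only moves the base point. *)
Fixpoint noisy (R : realType) (a : R) (a01 : 0 < a < 1) (n : nat)
    (ws : seq ('I_n -> R)) (b : 'I_n -> R) : probability (n.-tuple R) R :=
  if ws is w :: ws' then
    geom_mixture a01
      (fun i => noisy a01 ws' (fun j => b j + (i%:R + 2^-1) * w j))
      (fun i => noisy a01 ws' (fun j => b j - (i%:R + 2^-1) * w j))
  else \d_ (mktuple b).

Lemma nneseries_shift (R : realType) (f : nat -> \bar R) :
  (forall n, 0 <= f n)%E ->
  (\sum_(0 <= n <oo) f n = f 0%N + \sum_(0 <= n <oo) f n.+1)%E.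
Proof.
move=> f0; rewrite (nneseries_split 0%N 1%N)//= add0n big_nat1; congr (_ + _)%E.
by rewrite -nneseries_addn//; apply: eq_eseriesr => n _; rewrite addn1.
Qed.

(* Think of [f n] and [g n] as attached to the half-integers [n + 1/2] and
   [- (n + 1/2)]: the left-hand side is the mixture after translation by 1. *)
Lemma geom_shift_le (R : realType) (a : R) (f g : nat -> \bar R) :
  0 < a < 1 -> (forall n, 0 <= f n)%E -> (forall n, 0 <= g n)%E ->
  (\sum_(0 <= n <oo) ((1 - a) / 2 * a ^+ n)%:E *
      (f n.+1 + (if n is m.+1 then g m else f 0%N))
   <= a^-1%:E * \sum_(0 <= n <oo) ((1 - a) / 2 * a ^+ n)%:E * (f n + g n))%E.
Proof.
move=> a01 f0 g0.
have q0 n : (0 <= ((1 - a) / 2 * a ^+ n)%:E)%E by rewrite lee_fin geom_weight_ge0.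
have [a0 a1] := andP a01.
have split (u v : nat -> \bar R) : (forall n, 0 <= u n)%E -> (forall n, 0 <= v n)%E ->
   (\sum_(0 <= n <oo) ((1 - a) / 2 * a ^+ n)%:E * (u n + v n) =
    \sum_(0 <= n <oo) ((1 - a) / 2 * a ^+ n)%:E * u n
    + \sum_(0 <= n <oo) ((1 - a) / 2 * a ^+ n)%:E * v n)%E.
  move=> u0 v0; rewrite -nneseriesD; [|by move=> *; rewrite mule_ge0..].
  by apply: eq_eseriesr => n _; rewrite ge0_muleDr.
rewrite !split//; last by case.
rewrite ge0_muleDr; [|by apply: nneseries_ge0 => *; rewrite mule_ge0..].
rewrite [X in (_ + X <= _)%E]nneseries_shift; last by case=> *; rewrite mule_ge0.
rewrite [X in (_ <= _ * X + _)%E]nneseries_shift; last by move=> *; rewrite mule_ge0.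
rewrite ge0_muleDr ?mule_ge0//; last first.
  by apply: nneseries_ge0 => *; rewrite mule_ge0.
rewrite addeCA -addeA; apply: leeD.
  rewrite muleA -EFinM lee_wpmul2r// lee_fin ler_peMl ?geom_weight_ge0//.
  by rewrite invf_ge1// ltW.
rewrite -!nneseriesZl; [|by move=> *; rewrite mule_ge0..].
apply: leeD; apply: lee_nneseries => n *; rewrite ?mule_ge0// muleA -EFinM.
  by rewrite exprS mulrCA mulKf ?gt_eqF.
rewrite lee_wpmul2r// lee_fin exprS mulrCA ler_wpM2r ?geom_weight_ge0//.
by rewrite (le_trans (ltW a1))// invf_ge1// ltW.
Qed.

(** At the layer of [w] the shift moves every half-integer to a neighbouring one, which costs a
    single [a^-1]. Every other layer commutes with the shift, so the bound passes through it term by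
    term. *)
Lemma noisy_shift (R : realType) (a : R) (a01 : 0 < a < 1) (n : nat)
    (ws : seq ('I_n -> R)) (w b : 'I_n -> R) (s : bool) (S : set (n.-tuple R)) :
  measurable S -> w \in ws ->
  (noisy a01 ws (fun j => b j + (-1) ^+ s * w j)%R S <= a^-1%:E * noisy a01 ws b S)%E.
Proof.
move=> mS.
have [a0 _] := andP a01; have ai0 : (0 <= a^-1%:E)%E by rewrite lee_fin invr_ge0 ltW.
elim: ws b => // w' ws IH b.
rewrite inE => /predU1P[{IH}->|wws] /=; rewrite !geom_mixtureE.
  pose f i := noisy a01 ws (fun j => b j + (i%:R + 2^-1) * w' j) S.
  pose g i := noisy a01 ws (fun j => b j - (i%:R + 2^-1) * w' j) S.
  case: s.
    (* The shift by [- w'] is the mirror image: [f] and [g] exchange roles in [geom_shift_le]. *)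
    apply: le_trans (_ : (_ <= a^-1%:E * \sum_(0 <= n <oo)
       ((1 - a) / 2 * a ^+ n)%:E * (g n + f n)))%E _; last first.
      rewrite lee_wpmul2l//.
      by apply: lee_nneseries => *; [rewrite mule_ge0 ?lee_fin ?geom_weight_ge0// adde_ge0|rewrite addeC].
    apply: le_trans (geom_shift_le a01 _ _) => //.
    apply: lee_nneseries => [i *|i _].
      by rewrite mule_ge0 ?lee_fin ?geom_weight_ge0// adde_ge0.
    rewrite lee_wpmul2l ?lee_fin ?geom_weight_ge0// addeC le_eqVlt.
    apply/orP; left; apply/eqP; congr (_ + _)%E.
      congr (noisy _ _ _ _); apply/funext => j.
      by rewrite -(natr1 i) expr1; ring.
    (* For [i = 0] the noise [1/2] crosses zero to [- 1/2], the special case of the match in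
       [geom_shift_le]. *)
    by case: i => [|i]; congr (noisy _ _ _ _); apply/funext => j;
       rewrite ?add0r -?(natr1 i) expr1; field.
  apply: le_trans (geom_shift_le a01 _ _) => //.
  apply: lee_nneseries => [i *|i _].
    by rewrite mule_ge0 ?lee_fin ?geom_weight_ge0// adde_ge0.
  rewrite lee_wpmul2l ?lee_fin ?geom_weight_ge0// le_eqVlt.
  apply/orP; left; apply/eqP; congr (_ + _)%E.
    congr (noisy _ _ _ _); apply/funext => j.
    by rewrite -(natr1 i) expr0; ring.
  by case: i => [|i]; congr (noisy _ _ _ _); apply/funext => j;
     rewrite ?add0r -?(natr1 i) expr0; field.
rewrite -nneseriesZl; last first.
  by move=> *; rewrite mule_ge0 ?lee_fin ?geom_weight_ge0// adde_ge0.
apply: lee_nneseries => [i *|i _].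
  by rewrite mule_ge0 ?lee_fin ?geom_weight_ge0// adde_ge0.
rewrite muleCA lee_wpmul2l ?lee_fin ?geom_weight_ge0// ge0_muleDr//.
by apply: leeD; [under eq_fun do rewrite addrAC|under eq_fun do rewrite addrAC]; exact: IH.
Qed.

(** Noise values come in opposite pairs of equal weight, so cross terms cancel: the squared bias at
    [j] and the variances of the directions add up. *)
Lemma noisy_sq_error (R : realType) (a : R) (a01 : 0 < a < 1) (n : nat)
    (ws : seq ('I_n -> R)) (b : 'I_n -> R) (j : 'I_n) (c : R) :
  (\int[noisy a01 ws b]_y ((c - tnth y j) ^+ 2)%:E
   <= ((c - b j) ^+ 2 + 2 / (1 - a) ^+ 2 * \sum_(w <- ws) w j ^+ 2)%:E)%E.
Proof.
have mh : measurable_fun setT (fun y : n.-tuple R => ((c - tnth y j) ^+ 2)%:E).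
  apply/measurable_EFinP; apply: measurable_funX; apply: measurable_funB => //.
  exact: measurable_tnth.
have h0 (y : n.-tuple R) : (0 <= ((c - tnth y j) ^+ 2)%:E)%E by rewrite lee_fin sqr_ge0.
elim: ws b => [|w ws IH] b /=.
  by rewrite integral_dirac// diracT mul1e tnth_mktuple big_nil mulr0 addr0.
rewrite integral_geom_mixture// big_cons.
set s := \sum_(w <- ws) _ in IH *; set V := 2 / _ in IH *.
have s0 : 0 <= V * s.
  by rewrite mulr_ge0 ?sumr_ge0 ?divr_ge0 ?exprn_even_ge0// => *; exact: sqr_ge0.
pose d := (c - b j) ^+ 2 + V * s; have d0 : 0 <= d by rewrite addr_ge0 ?sqr_ge0.
have [a0 a1] := andP a01.
apply: le_trans (_ : (\sum_(0 <= i <oo) (d%:E * ((1 - a) * a ^+ i)%:E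
   + (w j ^+ 2)%:E * ((1 - a) * a ^+ i * (i%:R + 2^-1) ^+ 2)%:E) <= _))%E.
  apply: lee_nneseries => [i *|i _].
    by rewrite mule_ge0 ?lee_fin ?geom_weight_ge0// adde_ge0// integral_ge0.
  apply: (@le_trans _ _ (((1 - a) / 2 * a ^+ i)%:E * (((c - (b j + (i%:R + 2^-1) * w j)) ^+ 2 + V * s)%:E
     + ((c - (b j - (i%:R + 2^-1) * w j)) ^+ 2 + V * s)%:E)))%E.
    by rewrite lee_wpmul2l ?lee_fin ?geom_weight_ge0// leeD.
  by rewrite -!EFinM -!EFinD lee_fin le_eqVlt /d; apply/orP; left; apply/eqP; field.
have q0 i : 0 <= (1 - a) * a ^+ i by rewrite mulr_ge0 ?exprn_ge0 ?subr_ge0// ltW.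
rewrite nneseriesD; last 2 first.
- by move=> *; rewrite mule_ge0 ?lee_fin.
- by move=> *; rewrite mule_ge0 ?lee_fin ?sqr_ge0// mulr_ge0 ?sqr_ge0.
rewrite !nneseriesZl; last 2 first.
- by move=> *; rewrite lee_fin mulr_ge0 ?sqr_ge0.
- by move=> *; rewrite lee_fin.
rewrite geom_series// mule1.
apply: (@le_trans _ _ (d%:E + (w j ^+ 2)%:E * V%:E))%E.
  by rewrite leeD2l// lee_wpmul2l ?lee_fin ?sqr_ge0// geom_second_moment.
by rewrite -EFinM -EFinD lee_fin le_eqVlt /d; apply/orP; left; apply/eqP; ring.
Qed.

(** Privacy accounting in factors [a^-1]. All base points are allowed so that costs add along
    successive shifts, and both signs so that a shift and its negation cost the same. *)
Definition shift_cost (R : realType) (a : R) (a01 : 0 < a < 1) (n : nat)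
    (ws : seq ('I_n -> R)) (D : nat) (f : 'I_n -> R) : Prop :=
  forall (s : bool) (b : 'I_n -> R) (S : set (n.-tuple R)), measurable S ->
    (noisy a01 ws (fun j => b j + (-1) ^+ s * f j)%R S
      <= (a^-1 ^+ D)%:E * noisy a01 ws b S)%E.

Section ShiftCost.
Context (R : realType) (a : R) (a01 : 0 < a < 1) (n : nat).
Variable ws : seq ('I_n -> R).
Local Notation cost := (shift_cost a01 ws).

Lemma shift_cost0 (D : nat) : cost D (fun=> 0).
Proof.
move=> s b S mS; under eq_fun do rewrite mulr0 addr0.
have [a0 a1] := andP a01.
by rewrite -[leLHS]mul1e lee_wpmul2r// lee_fin exprn_ege1// invf_ge1// ltW.
Qed.

Lemma shift_costD (D D' : nat) (f g : 'I_n -> R) :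
  cost D f -> cost D' g -> cost (D + D') (fun j => f j + g j).
Proof.
move=> hf hg s b S mS; under eq_fun do rewrite mulrDr addrA.
apply: le_trans (hg s _ S mS) _.
have [a0 _] := andP a01.
rewrite addnC exprD EFinM -muleA lee_wpmul2l//; last exact: hf.
by rewrite lee_fin exprn_ge0// invr_ge0 ltW.
Qed.

Lemma shift_costN (D : nat) (f : 'I_n -> R) : cost D f -> cost D (fun j => - f j).
Proof.
move=> hf s b S mS; under eq_fun do rewrite mulrN -mulNr -signrN.
exact: hf.
Qed.

Lemma shift_cost_mem (m : nat) (w : 'I_n -> R) :
  w \in ws -> cost m (fun j => m%:R * w j).
Proof.
move=> wws; elim: m => [|m IH].
  by under eq_fun do rewrite mul0r; exact: shift_cost0.
under eq_fun do rewrite -natr1 mulrDl mul1r; rewrite -addn1.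
apply: shift_costD IH _ => s b S mS; rewrite expr1; exact: noisy_shift.
Qed.

End ShiftCost.

(** * Dyadic decomposition of prefix counts *)

(** One coarsening step: halving loses [v < p] only when [v] and [p] form a pair [2c], [2c + 1],
    which for given [v] singles out one value of [p]. *)
Lemma ltn_half (v p : nat) :
  (v < p)%N = ((v./2 < p./2)%N + (~~ odd v && (p == v.+1)))%N :> nat.
Proof. lia. Qed.

(** Blocks consist of prefix ends rather than records: a query sees a block only through its two
    ends. These range over [0..k], hence ['I_k.+1]. *)
Definition dyadic_query (R : realType) (k L m : nat) (i : 'I_L.+1 * 'I_k.+1)
    (j : 'I_(nqueries k)) : R :=
  m%:R^-1 * ((((workload_query j).2.+1 %/ 2 ^ i.1)%N == i.2)%:R
             - (((workload_query j).1 %/ 2 ^ i.1)%N == i.2)%:R).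

Definition dyadic_strategy (R : realType) (k L m : nat) : seq ('I_(nqueries k) -> R) :=
  [seq dyadic_query R m i | i <- index_enum ('I_L.+1 * 'I_k.+1)%type].

(** At each scale either end of the query lies in at most one block, so at most two directions see
    the query. *)
Lemma dyadic_strategy_sq_sum (R : realType) (k L m : nat) (j : 'I_(nqueries k)) :
  \sum_(w <- dyadic_strategy R k L m) w j ^+ 2 <= 2 * L.+1%:R / m%:R ^+ 2.
Proof.
rewrite big_map -(pair_bigA _ (fun i c => dyadic_query R m (i, c) j ^+ 2))/=.
have le1 (x : nat) : \sum_(c < k.+1) (x == c)%:R <= 1 :> R.
  have [xk|kx] := ltnP x k.+1.
    rewrite (bigD1 (Ordinal xk))//= eqxx big1 ?addr0// => c cx.
    by case: eqP => // E; case/eqP: cx; apply: val_inj.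
  by rewrite big1 ?ler01// => c _; rewrite gtn_eqF// (leq_trans _ kx).
apply: (@le_trans _ _ (\sum_(i < L.+1) 2 / m%:R ^+ 2)); last first.
  by rewrite sumr_const card_ord -mulr_natr le_eqVlt; apply/orP; left; apply/eqP; ring.
apply: ler_sum => i _; rewrite /dyadic_query/=.
under eq_bigr do rewrite exprMn exprVn.
rewrite -mulr_sumr mulrC ler_wpM2r ?invr_ge0 ?sqr_ge0//.
apply: (@le_trans _ _ (1 + 1)); last by [].
apply: le_trans (lerD (le1 ((workload_query j).2.+1 %/ 2 ^ i)%N)
                      (le1 ((workload_query j).1 %/ 2 ^ i)%N)).
(* On [0]/[1] values a squared difference is at most the sum. *)
rewrite -big_split/=; apply: ler_sum => c _.
by do 2 case: (_ == _) => /=; lra.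
Qed.

Section DyadicDecomposition.
Context (R : realType) (a : R) (a01 : 0 < a < 1) (k L m : nat).
Hypothesis m_gt0 : (0 < m)%N.

(* [h] is a function of the end point of a prefix [{0, .., p - 1}] of the
   domain; a range query is a difference of two prefix queries. *)
Let cost D (h : nat -> R) := shift_cost a01 (dyadic_strategy R k L m) D
  (fun j => h (workload_query j).2.+1 - h (workload_query j).1).

Let costD D D' (f g : nat -> R) :
  cost D f -> cost D' g -> cost (D + D') (fun p => f p + g p).
Proof.
move=> hf hg; have := shift_costD hf hg; rewrite /cost.
by congr shift_cost; apply/funext => j; ring.
Qed.

Let costN D (f : nat -> R) : cost D f -> cost D (fun p => - f p).
Proof.
move=> /shift_costN; rewrite /cost.
by congr shift_cost; apply/funext => j; ring.
Qed.

(** [m] unit steps along a direction undo its scaling by [1/m]. The flag [b] gives a term that may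
    be absent the same cost. *)
Let cost_dyadic (i c : nat) (b : bool) : (i <= L)%N -> (c <= k)%N ->
  cost m (fun p => (b && (p %/ 2 ^ i == c)%N)%:R).
Proof.
move=> iL ck; rewrite /cost; case: b => /=; last first.
  by under eq_fun do rewrite subrr; exact: shift_cost0.
have mem : dyadic_query R m (Ordinal (iL : (i < L.+1)%N), Ordinal (ck : (c < k.+1)%N))
    \in dyadic_strategy R k L m by apply: map_f; rewrite mem_index_enum.
have := shift_cost_mem a01 m mem.
congr shift_cost; apply/funext => j; rewrite /dyadic_query mulrA divff ?mul1r//.
by rewrite pnatr_eq0 -lt0n.
Qed.

(** Telescopes [ltn_half] over the scales; each coarsening pays for at most one block. *)
Let cost_coarsen (v i : nat) : (v < k)%N -> (i <= L)%N ->
  cost (i * m) (fun p => (v < p)%N%:R - (v %/ 2 ^ i < p %/ 2 ^ i)%N%:R).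
Proof.
move=> vk; elim: i => [|i IH] iL.
  have -> : (fun p => (v < p)%N%:R - (v %/ 2 ^ 0 < p %/ 2 ^ 0)%N%:R) = (fun=> 0 : R).
    by apply/funext => p; rewrite expn0 !divn1 subrr.
  by rewrite /cost; under eq_fun do rewrite subrr; exact: shift_cost0.
have vik : (v %/ 2 ^ i < k)%N by rewrite (leq_ltn_trans (leq_div _ _)).
have := costD (IH (ltnW iL))
  (cost_dyadic (~~ odd (v %/ 2 ^ i)) (ltnW iL) vik).
rewrite mulSn addnC; congr cost; apply/funext => p.
rewrite expnSr !divnMA !divn2 (ltn_half (v %/ 2 ^ i)) natrD; ring.
Qed.

(** Coarsening both thresholds to scale [2 ^ L] costs [L * m] each. There [u] and [v] fall in equal
    or adjacent blocks, so one more block indicator accounts for the difference. *)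
Lemma dyadic_interval_cost (u v : nat) : (u < k)%N -> (v < k)%N ->
  (u - v <= 2 ^ L)%N -> (v - u <= 2 ^ L)%N ->
  shift_cost a01 (dyadic_strategy R k L m) (L.*2.+1 * m)
    (fun j => ((v < (workload_query j).2.+1)%N%:R - (u < (workload_query j).2.+1)%N%:R)
      - ((v < (workload_query j).1)%N%:R - (u < (workload_query j).1)%N%:R)).
Proof.
wlog uv : u v / (u <= v)%N.
  move=> hw uk vk uvL vuL; have [uv|/ltnW vu] := leqP u v; first exact: hw.
  have := shift_costN (hw v u vu vk uk vuL uvL).
  by congr shift_cost; apply/funext => j; ring.
move=> uk vk _ vuL; rewrite -/(cost _ (fun p => (v < p)%N%:R - (u < p)%N%:R)).
have /andP[uvL vuL1] : (u %/ 2 ^ L <= v %/ 2 ^ L <= (u %/ 2 ^ L).+1)%N.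
  rewrite leq_div2r//= -[(u %/ 2 ^ L).+1]addn1.
  have M0 : (0 < 2 ^ L)%N by rewrite expn_gt0.
  have -> : (u %/ 2 ^ L + 1 = (u + 2 ^ L) %/ 2 ^ L)%N by rewrite divnDr// divnn M0.
  by rewrite leq_div2r// -leq_subLR.
have ck : (v %/ 2 ^ L <= k)%N by rewrite (leq_trans (leq_div _ _))// ltnW.
have := costD (costD (cost_coarsen vk (leqnn L)) (costN (cost_coarsen uk (leqnn L))))
  (costN (cost_dyadic (u %/ 2 ^ L < v %/ 2 ^ L)%N (leqnn L) ck)).
rewrite -mulnDl addnn -mulSnr; congr cost; apply/funext => p.
have -> : (u %/ 2 ^ L < p %/ 2 ^ L)%N%:R = (v %/ 2 ^ L < p %/ 2 ^ L)%N%:R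
  + ((u %/ 2 ^ L < v %/ 2 ^ L)%N && (p %/ 2 ^ L == v %/ 2 ^ L)%N)%:R :> R.
  by rewrite -natrD; congr _%:R; move: (p %/ _)%N uvL vuL1 => p'; lia.
ring.
Qed.

End DyadicDecomposition.

(** * The range workload and logarithm bounds *)

(** The change is [h (q.2 + 1) - h q.1] for [h p = (v < p) - (u < p)], the form whose cost
    [dyadic_interval_cost] bounds. *)
Lemma range_answer_move (R : realType) (k : nat) (u v : 'I_k) (x : 'I_k -> R)
    (q : 'I_k * 'I_k) : (q.1 <= q.2)%N ->
  range_answer q (fun i => x i - (i == u)%:R + (i == v)%:R) =
  range_answer q x + (((v < q.2.+1)%N%:R - (u < q.2.+1)%N%:R)
    - ((v < q.1)%N%:R - (u < q.1)%N%:R)).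
Proof.
move=> q12; rewrite /range_answer !big_split/= -addrA; congr (_ + _).
have ind (w : 'I_k) : \sum_(i < k | (q.1 <= i <= q.2)%N) (i == w)%:R =
    (w < q.2.+1)%N%:R - (w < q.1)%N%:R :> R.
  have -> : (w < q.2.+1)%N%:R = (q.1 <= w <= q.2)%N%:R + (w < q.1)%N%:R :> R.
    by rewrite -natrD; congr _%:R; move: q12; lia.
  rewrite addrK big_mkcond (bigD1 w)//= eqxx big1 ?addr0; first by case: ifP.
  by move=> i /negbTE->; case: ifP.
rewrite sumrN !ind; ring.
Qed.

Lemma workload_query_le (k : nat) (j : 'I_(nqueries k)) :
  ((workload_query j).1 <= (workload_query j).2)%N.
Proof.
have := mem_tnth j (in_tuple (range_workload k)).
rewrite -/(workload_query j) => /flattenP[s /mapP[l _ ->]] /mapP[r].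
by rewrite mem_filter => /andP[lr _] ->.
Qed.

Lemma ln2_ge_half (R : realType) : 2^-1 <= ln (2 : R).
Proof.
(* [ln (1 + x) <= x] at [x = - 1/2], as [ln 2 = - ln (1/2)]. *)
have h : -1 < - 2^-1 :> R by lra.
have := le_ln1Dx h; have -> : 1 - 2^-1 = 2^-1 :> R by field.
by rewrite lnV ?posrE//; lra.
Qed.

Lemma trunc_log2_le_ln (R : realType) (n : nat) : (0 < n)%N ->
  (trunc_log 2 n)%:R <= 2 * ln (n%:R : R).
Proof.
move=> n0; have /andP[+ _] := trunc_log_bounds (isT : (1 < 2)%N) n0.
rewrite -(ler_nat R) natrX -ler_ln ?posrE ?exprn_gt0 ?ltr0n// lnXn//.
have := ler_wpM2r (ler0n R (trunc_log 2 n)) (ln2_ge_half R).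
by rewrite -mulr_natr; lra.
Qed.

(** The bound uses [1 + ln theta] since [ln theta] vanishes at [theta = 1]. *)
Theorem theorem5p5 (R : realType) :
  exists C : R, 0 < C /\
  forall (k theta : nat) (eps : R), (1 <= k)%N -> (1 <= theta)%N -> 0 < eps ->
  exists M : mechanism R k,
    blowfish_private theta eps M /\
    error_per_query_le M (C * (1 + ln (theta%:R)) ^+ 3 / eps ^+ 2).
Proof.
(* This is [16 * 4 ^+ 3]: 8 from the noise variance, 2 from the strategy, and 4 from each of three
   factors linear in [L], all at most [4 * lam]. *)
exists (4 ^+ 5); split=> [|k theta eps k1 theta1 eps0]; first exact: exprn_gt0.
pose L := (trunc_log 2 theta).+1.
have /andP[theta_ge theta_lt] : (2 ^ L.-1 <= theta < 2 ^ L)%N.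
  exact: trunc_log_bounds.
(* [m > eps] forces [t <= 1], which keeps the variance bound of one noise at [8 / t ^+ 2]. *)
pose m := (Num.truncn eps).+1.
have m_gt : eps < m%:R by rewrite truncnS_gt.
pose D := (L.*2.+1 * m)%N.
have D0 : 0 < D%:R :> R by rewrite ltr0n muln_gt0.
pose t := eps / D%:R.
have t0 : 0 < t by rewrite divr_gt0.
have t1 : t <= 1.
  rewrite ler_pdivrMr// mul1r (le_trans (ltW m_gt))// ler_nat.
  by rewrite leq_pmull.
(* With [a^-1 = 1 + t], the total factor [(1 + t) ^+ D] is at most [expR (D * t) = expR eps]. *)
have a01 : 0 < (1 + t)^-1 < 1.
  by rewrite invr_gt0 invf_lt1 ?ltrDl ?addr_gt0 ?t0.
pose M : mechanism R k := fun x =>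
  noisy a01 (dyadic_strategy R k L m) (fun j => range_answer (workload_query j) x).
exists M; split.
  move=> x _ [u [v [/and3P[_ uv vu] ->]]] S mS.
  have theta_le := ltnW theta_lt.
  have := @dyadic_interval_cost R _ a01 k L m isT u v (ltn_ord u) (ltn_ord v)
    (leq_trans uv theta_le) (leq_trans vu theta_le).
  set x' : 'I_k -> R := fun i => _.
  (* Sign [true]: shifting back from [x'] gives the law at [x]. *)
  move=> /(_ true (fun j => range_answer (workload_query j) x') S mS).
  rewrite -/D; set b := (X in noisy _ _ X _).
  have -> : b = fun j => range_answer (workload_query j) x.
    apply/funext => j; rewrite /b /x' range_answer_move ?workload_query_le//.
    by rewrite expr1; ring.
  move=> h; apply: le_trans h _; rewrite lee_wpmul2r// lee_fin invrK.
  have -> : eps = D%:R * t by rewrite /t mulrC divfK// gt_eqF.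
  by rewrite expRM_natl lerXn2r ?nnegrE ?expR_ge0 ?expR_ge1Dx// addr_ge0 ?ltW.
set lam := 1 + ln _; set B := 4 ^+ 5 * _ / _.
have L_le : L%:R <= 2 * lam - 1.
  rewrite /L -natr1 /lam; have := trunc_log2_le_ln R theta1; lra.
have L1_le : (L.*2.+1)%:R <= 4 * lam.
  by rewrite -natr1 -muln2 natrM; move: L_le (ler0n R L); lra.
have L1_le' : L.+1%:R <= 4 * lam.
  by apply: le_trans L1_le; rewrite ler_nat ltnS -addnn leq_addr.
have B0 : 0 <= B.
  have lam0 : 0 <= lam by move: L_le (ler0n R L); lra.
  by rewrite /B divr_ge0 ?mulr_ge0 ?exprn_ge0// ltW.
have query_error x (j : 'I_(nqueries k)) :
    (\int[M x]_y ((range_answer (workload_query j) x - tnth y j) ^+ 2)%:E <= B%:E)%E.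
  apply: le_trans (noisy_sq_error a01 _ _ _ _) _.
  rewrite lee_fin subrr expr0n add0r.
  have le_t : 2 / (1 - (1 + t)^-1) ^+ 2 <= 8 / t ^+ 2.
    have -> : 2 / (1 - (1 + t)^-1) ^+ 2 = 2 * (1 + t) ^+ 2 / t ^+ 2.
      by field; rewrite !gt_eqF// ?addr_gt0//; lra.
    by rewrite ler_wpM2r ?invr_ge0 ?sqr_ge0//; nra.
  apply: le_trans (ler_pM _ _ le_t (@dyadic_strategy_sq_sum R k L m j)) _.
  - by rewrite divr_ge0 ?sqr_ge0.
  - by apply: sumr_ge0 => *; exact: sqr_ge0.
  (* The factor [m] in [D] cancels the scaling of the directions by [1/m]. *)
  have -> : 8 / t ^+ 2 * (2 * L.+1%:R / m%:R ^+ 2)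
      = 16 * ((L.*2.+1)%:R ^+ 2 * L.+1%:R) / eps ^+ 2.
    by rewrite /t /D natrM; field; rewrite !gt_eqF.
  rewrite /B ler_wpM2r ?invr_ge0 ?sqr_ge0//.
  have -> : 4 ^+ 5 * lam ^+ 3 = 16 * ((4 * lam) ^+ 2 * (4 * lam)) by ring.
  by rewrite ler_wpM2l// ler_pM ?sqr_ge0// lerXn2r ?nnegrE// (le_trans _ L1_le).
move=> x; rewrite /total_sq_error.
apply: (@le_trans _ _ ((nqueries k)%:R^-1%:E * \sum_(j < nqueries k) B%:E))%E.
  rewrite lee_wpmul2l ?lee_fin ?invr_ge0//; apply: lee_sum => j _; exact: query_error.
rewrite sumEFin sumr_const card_ord -EFinM lee_fin -(mulr_natl B) mulrA.
have [->|nq0] := eqVneq (nqueries k) 0%N; first by rewrite mulr0 mul0r.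
by rewrite mulVf ?mul1r// pnatr_eq0.
Qed.
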